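(* Let $\mathbb{S}^n\subset\mathbb{R}^{n+1}$ be the standard unit sphere with its standard Riemannian metric, let $\Delta_S$ denote its Laplace-Beltrami operator, let $0<\rho<\pi$, and let $B(\rho)\subset\mathbb{S}^n$ be a (geodesic) ball of radius $\rho$. Let $h\colon B(\rho)\to\mathbb{R}$ be a harmonic function, i.e. $\Delta_S h=0$ on $B(\rho)$. Then for all $k\in\mathbb{N}$, $$\Delta_S^k\,|h|^2\ \geq\ 0$$ at every point of $B(\rho)$.
   Context: The Laplace-Beltrami operator is taken with the sign convention $\Delta f=\operatorname{div}\operatorname{grad} f=\operatorname{tr}(Y\mapsto\nabla_Y\operatorname{grad} f)$ (so that in Euclidean space it is $\sum_j\partial_j^2$). $\Delta_S^k$ denotes the $k$-fold composition of $\Delta_S$. *)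

(* Defs.v *)
From HB Require Import structures.
From mathcomp Require Import all_boot all_order all_algebra.
From mathcomp Require Import all_classical all_reals all_analysis.
Set Implicit Arguments.
Unset Strict Implicit.
Unset Printing Implicit Defensive.
Import Order.TTheory GRing.Theory Num.Theory.
Import numFieldNormedType.Exports.
Local Open Scope classical_set_scope.
Local Open Scope ring_scope.

Definition dot (R : realType) (m : nat) (u v : 'rV[R]_m) : R :=
  \sum_(i < m) u 0 i * v 0 i.

(* The library norm on row vectors is the sup norm. *)
Definition enorm (R : realType) (m : nat) (u : 'rV[R]_m) : R :=
  Num.sqrt (dot u u).

(* S^n in R^(n+1), with the metric induced by [dot]. *)
Definition sphere (R : realType) (n : nat) : set 'rV[R]_n.+1 :=
  [set x | enorm x = 1].

(* The geodesic distance between points x, y of the unit sphere is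
   the angle acos (dot x y). *)
Definition geodesic_ball (R : realType) (n : nat)
    (q : 'rV[R]_n.+1) (rho : R) : set 'rV[R]_n.+1 :=
  [set x | sphere x /\ acos (dot x q) < rho].

(* C^oo on W: all iterated directional derivatives exist and are Frechet
   differentiable (hence continuous) at the points of W. *)
Definition esmooth (R : realType) (n : nat)
    (W : set 'rV[R]_n.+1) (F : 'rV[R]_n.+1 -> R) : Prop :=
  forall (vs : seq 'rV[R]_n.+1) (x : 'rV[R]_n.+1), W x ->
    differentiable (foldr (fun v (G : 'rV[R]_n.+1 -> R) => 'D_v G) F vs) x.

(* Smoothness of a function on a subset U of R^(n+1), used for U open in the
   sphere: locally, f is the restriction of a C^oo function. *)
Definition smooth_on (R : realType) (n : nat)
    (U : set 'rV[R]_n.+1) (f : 'rV[R]_n.+1 -> R) : Prop :=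
  forall p, U p -> exists (W : set 'rV[R]_n.+1) (F : 'rV[R]_n.+1 -> R),
    [/\ open W, W p, esmooth W F & forall x, W x -> U x -> f x = F x].

Definition retr (R : realType) (n : nat) (x : 'rV[R]_n.+1) : 'rV[R]_n.+1 :=
  (enorm x)^-1 *: x.

(* Derivative at a point p of the sphere, along a tangent vector v, of a map f
   on the sphere: for v orthogonal to p, t |-> retr (p + t v) is a curve on the
   sphere with initial point p and initial velocity v, and this is the
   derivative of f along it at t = 0.  Only the values of f on the sphere
   matter. *)
Definition sdiff (R : realType) (n : nat) (V : normedModType R)
    (f : 'rV[R]_n.+1 -> V) (p v : 'rV[R]_n.+1) : V :=
  'D_v (f \o @retr R n) p.

(* Orthogonal projection onto the tangent space p^\perp of the sphere at p. *)
Definition tproj (R : realType) (n : nat) (p v : 'rV[R]_n.+1) : 'rV[R]_n.+1 :=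
  v - dot v p *: p.

(* The tangent vector g at p with dot g v = sdiff f p v for all tangent v: its
   coordinates are dot g e_i = dot g (tproj p e_i) = sdiff f p (tproj p e_i). *)
Definition sgrad (R : realType) (n : nat)
    (f : 'rV[R]_n.+1 -> R) (p : 'rV[R]_n.+1) : 'rV[R]_n.+1 :=
  \row_(i < n.+1) sdiff f p (tproj p (delta_mx 0 i)).

(* Levi-Civita connection (nabla_Y X)(p) of the induced metric: tangential part
   of the derivative in R^(n+1) of the vector field X along Y. *)
Definition snabla (R : realType) (n : nat)
    (X : 'rV[R]_n.+1 -> 'rV[R]_n.+1) (p Y : 'rV[R]_n.+1) : 'rV[R]_n.+1 :=
  tproj p (sdiff X p Y).

(* The trace of the endomorphism Y |-> nabla_Y X of the tangent space at p,
   computed in R^(n+1) after extending it by 0 on the normal line R p. *)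
Definition sdiv (R : realType) (n : nat)
    (X : 'rV[R]_n.+1 -> 'rV[R]_n.+1) (p : 'rV[R]_n.+1) : R :=
  \tr (lin1_mx (fun Y : 'rV[R]_n.+1 => snabla X p (tproj p Y))).

Definition laplace_beltrami (R : realType) (n : nat)
    (f : 'rV[R]_n.+1 -> R) : 'rV[R]_n.+1 -> R :=
  sdiv (sgrad f).

Definition harmonic_on (R : realType) (n : nat)
    (U : set 'rV[R]_n.+1) (h : 'rV[R]_n.+1 -> R) : Prop :=
  smooth_on U h /\ forall p, U p -> laplace_beltrami h p = 0.

(* Main.v *)
Require Import Defs.
From HB Require Import structures.
From mathcomp Require Import all_boot all_order all_algebra.
From mathcomp Require Import all_classical all_reals all_analysis.
From mathcomp Require Import ring lra.
Import Order.TTheory GRing.Theory Num.Theory.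
Import numFieldNormedType.Exports.
Local Open Scope classical_set_scope.
Local Open Scope ring_scope.
Set Implicit Arguments.
Unset Strict Implicit.
Unset Printing Implicit Defensive.

(** Extend [h] to the cone over the ball as a harmonic function [F] that is
    homogeneous of degree 0. The rotation fields
    [X_ij = x_i d_j - x_j d_i] preserve homogeneity and harmonicity, and for
    every such [F], since [sum_k x_k d_k F = 0],
      [|x|^2 Lap (F^2) = 2 |x|^2 |grad F|^2 = sum_ij (X_ij F)^2].
    Hence the Laplace-Beltrami operator maps sums of squares of harmonic
    functions to sums of squares of harmonic functions. *)

(** Nonnegativity by itself says nothing about the sign of the next Laplacian, so the induction on
    the power carries the stronger property of being a sum of squares of harmonic functions. Degree
    0 is chosen because the radial derivative then vanishes: at points of the sphere the Euclidean
    Laplacian of the extension [f \o retr] is [laplace_beltrami f], with no radial correction. A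
    function harmonic on the ball therefore gives an extension harmonic on the sphere part of the
    cone, hence on the whole cone, the Laplacian being homogeneous of degree -2. That degree is also
    the obstacle to iterating the Euclidean Laplacian itself: [lap (F^2)] no longer has degree 0. At
    each step the result is restricted to the sphere, where the factor [|x|^2] is 1, and extended
    again with degree 0; the squares of the rotated functions are exactly this extension. *)

Lemma near_eq_differentiable (R : realType) (V W : normedModType R)
    (f g : V -> W) (x : V) :
  (\near x, f x = g x) -> differentiable f x -> differentiable g x.
Proof.
move=> fg df; apply/diff_locallyP.
have gx : g x = f x by apply/esym; exact: (nbhs_singleton fg).
have E : g \o shift x = cst (g x) + 'd f x +o_ 0 id.
  apply/eqaddoP => _/posnumP[e].
  have /eqaddoP/(_ e%:num (ltac:(by []))) := diff_locally df.
  move: fg; rewrite (near_shift 0) subr0; apply: filterS2 => y /= fgy.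
  by rewrite !fctE /= fgy gx.
have := diff_unique (diff_continuous df) E.
by move=> ->; split => //; exact: diff_continuous.
Qed.

(** * Locality of derivatives on an open set *)

Section open_eq.
Context {R : realType} {V : normedModType R} (O : set V).
Hypothesis openO : open O.

Lemma open_eq_near (W : Type) (f g : V -> W) (x : V) : O x ->
  {in O, f =1 g} -> \near x, f x = g x.
Proof.
move=> Ox fg; move: openO; rewrite openE => /(_ x Ox).
by apply: filterS => y Oy; apply: fg; rewrite inE.
Qed.

Lemma open_eq_derive (W : normedModType R) (f g : V -> W) (x v : V) : O x ->
  {in O, f =1 g} -> 'D_v f x = 'D_v g x.
Proof. by move=> Ox fg; apply: near_eq_derive; exact: open_eq_near. Qed.

Lemma open_eq_differentiable (W : normedModType R) (f g : V -> W) (x : V) :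
  O x -> {in O, f =1 g} -> differentiable f x -> differentiable g x.
Proof. by move=> Ox fg; apply: near_eq_differentiable; exact: open_eq_near. Qed.

End open_eq.

(** * Symmetry of second directional derivatives *)

Section schwarz.
Context {R : realType} {V : normedModType R}.
Implicit Types (F : V -> R) (x y u v : V).

Lemma is_diff_shift x v : is_diff x (fun y => y + v) id.
Proof.
have d := is_diffD (is_diff_id x) (is_diff_cst v x).
apply: (is_diff_eq d); apply/funext => y; exact: addr0.
Qed.

Lemma is_derive_line F y v (s : R) : differentiable F (y + s *: v) ->
  is_derive s 1 (fun r : R => F (y + r *: v)) ('D_v F (y + s *: v)).
Proof.
move=> dF.
have dl : is_diff s (fun r : R => y + r *: v) (fun r : R => r *: v).
  have d := is_diffD (is_diff_cst y s) (is_diff_scalel s v).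
  apply: (is_diff_eq d); apply/funext => r; exact: add0r.
have dF' : is_diff (y + s *: v) F ('d F (y + s *: v)) by exact: differentiableP.
have dc : is_diff s (F \o (fun r : R => y + r *: v))
    ('d F (y + s *: v) \o (fun r : R => r *: v)) by exact: is_diff_comp.
apply: DeriveDef; first exact/diff_derivable/ex_diff.
by rewrite deriveE ?diff_val//= scale1r deriveE.
Qed.

Lemma MVT_line F y v (t : R) : 0 < t ->
  (forall s, 0 <= s <= t -> differentiable F (y + s *: v)) ->
  exists2 c, 0 < c < t & F (y + t *: v) - F y = t * 'D_v F (y + c *: v).
Proof.
move=> t0 dF.
have [||c ct] := @MVT R (fun r => F (y + r *: v))
    (fun r => 'D_v F (y + r *: v)) 0 t t0.
- move=> s; rewrite in_itv/= => /andP[s0 st].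
  by apply: is_derive_line; apply: dF; rewrite !ltW.
- apply: continuous_in_subspaceT => s; rewrite inE/= in_itv/= => st.
  apply: differentiable_continuous; apply/derivable1_diffP.
  by have [] := is_derive_line (dF s st).
rewrite scale0r addr0 subr0 mulrC => E.
by exists c => //; move: ct; rewrite in_itv.
Qed.

Lemma nbhs_parallelogram x u v (P : set V) : nbhs x P ->
  exists2 t : R, 0 < t &
    forall a b, 0 <= a <= t -> 0 <= b <= t -> P (x + a *: u + b *: v).
Proof.
move=> /nbhs_ballP[r /= r0 rP].
have M0 : 0 < `|u| + `|v| + 1 by rewrite ltr_wpDl.
(* The [+ 1] keeps the denominator positive even if [u] and [v] vanish. A displacement has norm at
   most [t * (|u| + |v|)], which is below [r / 2]. *)
exists (r / (`|u| + `|v| + 1) / 2); first by rewrite !divr_gt0.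
set t := _ / 2 => a b /andP[a0 at_] /andP[b0 bt].
apply: rP; rewrite -ball_normE /= -addrA opprD addNKr normrN.
apply: (le_lt_trans (ler_normD _ _)); rewrite !normrZ !ger0_norm//.
have t0 : 0 < t by rewrite /t !divr_gt0.
have E : t * (`|u| + `|v| + 1) * 2 = r.
  by rewrite /t; field; rewrite gt_eqF.
have := ler_wpM2r (normr_ge0 u) at_.
have := ler_wpM2r (normr_ge0 v) bt.
have : 0 <= t * (`|u| + `|v|) by rewrite mulr_ge0 // ltW.
by move: E t0; rewrite !mulrDr; lra.
Qed.

(** The mean value theorem is applied twice: along [u] to the increment [G] of [F] in direction
    [t *: v], then along [v] to ['D_u F]. *)
Lemma second_difference F x u v (t : R) : 0 < t ->
  (forall a b, 0 <= a <= t -> 0 <= b <= t ->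
     differentiable F (x + a *: u + b *: v) /\
     differentiable ('D_u F) (x + a *: u + b *: v)) ->
  exists a b, [/\ 0 <= a <= t, 0 <= b <= t &
    F (x + t *: u + t *: v) - F (x + t *: u) - (F (x + t *: v) - F x) =
    t ^+ 2 * 'D_v ('D_u F) (x + a *: u + b *: v)].
Proof.
move=> t0 dF.
have t00 : 0 <= (0 : R) <= t by rewrite lexx ltW.
have tt : 0 <= t <= t by rewrite lexx ltW.
pose G y := F (y + t *: v) - F y.
have dG (s : R) : 0 <= s <= t -> is_diff (x + s *: u) G
    (fun w => 'd F (x + s *: u + t *: v) w - 'd F (x + s *: u) w).
  move=> st.
  have d1 : is_diff (x + s *: u) F ('d F (x + s *: u)).
    by apply: differentiableP; have [] := dF s 0 st t00; rewrite scale0r addr0.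
  have d2 : is_diff (x + s *: u + t *: v) F ('d F (x + s *: u + t *: v)).
    by apply: differentiableP; have [] := dF s t st tt.
  have d3 := is_diff_shift (x + s *: u) (t *: v).
  have d4 : is_diff (x + s *: u) (F \o (fun y => y + t *: v))
      ('d F (x + s *: u + t *: v) \o id) by exact: (is_diff_comp d3 d2).
  exact: (is_diffB d4 d1).
have [|a /andP[/ltW a0 /ltW at_] E1] := @MVT_line G x u t t0.
  by move=> s /dG [].
have ha : 0 <= a <= t by rewrite a0.
have [|b /andP[/ltW b0 /ltW bt] E2] := @MVT_line ('D_u F) (x + a *: u) v t t0.
  by move=> s st; have [] := dF a s ha st.
exists a, b; split => //; first by rewrite b0.
have dGa := dG a ha.
have E3 : 'D_u G (x + a *: u) =
    'D_u F (x + a *: u + t *: v) - 'D_u F (x + a *: u).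
  rewrite deriveE// diff_val/= deriveE; last by have [] := dF a t ha tt.
  rewrite deriveE//.
  by have [] := dF a 0 ha t00; rewrite scale0r addr0.
by rewrite -[LHS]/(G _ - G _) E1 E3 E2 expr2 mulrA.
Qed.

(** The second difference is symmetric in its two directions, so the two orders of applying the mean
    value theorem give equal mixed derivatives, taken at possibly different points. *)
Lemma second_difference_uniq (t a b c d A B : R) : 0 < t ->
  a - b - (c - d) = t ^+ 2 * A -> a - c - (b - d) = t ^+ 2 * B -> A = B.
Proof.
move=> t0 EA EB; apply: (@mulfI _ (t ^+ 2)); first by rewrite expf_neq0// gt_eqF.
by rewrite -EA -EB; ring.
Qed.

(** Schwarz's theorem. On a small parallelogram both mixed derivatives stay within [e / 2] of their
    values at [x], and by the second difference they take a common value there; hence the values at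
    [x] differ by at most [e]. *)
Lemma derive_comm F (O : set V) x u v : open O -> O x ->
  (forall y, O y -> [/\ differentiable F y, differentiable ('D_u F) y &
                        differentiable ('D_v F) y]) ->
  {for x, continuous ('D_u ('D_v F))} -> {for x, continuous ('D_v ('D_u F))} ->
  'D_u ('D_v F) x = 'D_v ('D_u F) x.
Proof.
move=> oO Ox dF cA cB.
apply/eqP; rewrite -subr_eq0 -normr_eq0; apply/eqP/le_anti.
rewrite normr_ge0 andbT; apply/ler_addgt0Pl => e e0; rewrite addr0.
have e20 : 0 < e / 2 by rewrite divr_gt0.
have nO : nbhs x O by move: oO; rewrite openE; exact.
move/cvgrPdistC_lt : cA => /(_ _ e20) nA; move/cvgrPdistC_lt : cB => /(_ _ e20) nB.
have [t t0 Pt] := nbhs_parallelogram u v (filterI nO (filterI nA nB)).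
have [|a [b [ha hb Eab]]] := @second_difference F x u v t t0.
  by move=> a b ha hb; have [/dF[]] := Pt a b ha hb.
have [|a' [b' [ha' hb' Eab']]] := @second_difference F x v u t t0.
  move=> a' b' ha' hb'; have [/dF[]] := Pt b' a' hb' ha'.
  by rewrite [x + b' *: u + _]addrAC.
have [_ [_ hB]] := Pt a b ha hb.
have [_ [hA _]] := Pt b' a' hb' ha'.
rewrite (addrAC x) in hA.
rewrite [x + t *: v + _]addrAC in Eab'.
have E := second_difference_uniq t0 Eab' Eab.
rewrite E in hA.
apply: (le_trans (ler_distD ('D_v ('D_u F) (x + a *: u + b *: v)) _ _)).
rewrite [leRHS](splitr e); apply: lerD; apply: ltW; last exact: hB.
by rewrite distrC; exact: hA.
Qed.

End schwarz.

(** * Chain rule and partial derivatives *)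

Lemma derive_comp (R : realType) (U V W : normedModType R) (f : U -> V)
    (g : V -> W) (x v : U) :
  differentiable f x -> differentiable g (f x) ->
  'D_v (g \o f) x = 'D_('D_v f x) g (f x).
Proof.
move=> df dg.
have dc : differentiable (g \o f) x by exact: differentiable_comp.
by rewrite (deriveE _ dc) (deriveE _ dg) (deriveE _ df) diff_comp.
Qed.

(* Locked, since unfolding partial derivatives to limits makes failing
   unification problems intractable. *)
HB.lock Definition pd (R : realType) (n : nat) (i : 'I_n.+1)
    (F : 'rV[R]_n.+1 -> R) : 'rV[R]_n.+1 -> R := 'D_(delta_mx 0 i) F.

Section partial.
Context {R : realType} {n : nat}.
Notation V := 'rV[R]_n.+1.
Implicit Types (x v w : V) (F G : V -> R).

Lemma derive_sum_pd F x v : differentiable F x ->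
  'D_v F x = \sum_i v 0 i * pd i F x.
Proof.
move=> dF; rewrite (deriveE _ dF) [v in LHS]row_sum_delta linear_sum.
by apply: eq_bigr => i _; rewrite linearZ pd.unlock (deriveE _ dF).
Qed.

Lemma derive_addr F x v w : differentiable F x ->
  'D_(v + w) F x = 'D_v F x + 'D_w F x.
Proof. by move=> dF; rewrite !(deriveE _ dF) linearD. Qed.

Lemma derive_scaler F x (c : R) v : differentiable F x ->
  'D_(c *: v) F x = c * 'D_v F x.
Proof. by move=> dF; rewrite !(deriveE _ dF) linearZ. Qed.

Lemma deriv_coord (i : 'I_n.+1) x v : 'D_v (fun y : V => y 0 i) x = v 0 i.
Proof.
have dM : derivable (@id V) x v by exact: derivable_id.
have /matrixP/(_ 0 i) := derive_mx dM.
by rewrite derive_id mxE.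
Qed.

Lemma pd_cst k (c : R) x : pd k (fun=> c) x = 0.
Proof. by rewrite pd.unlock; exact: derive_cst. Qed.

Lemma pd_coord k i x : pd k (fun y : V => y 0 i) x = (k == i)%:R.
Proof. by rewrite pd.unlock deriv_coord mxE eqxx eq_sym. Qed.

End partial.

(** * Closure properties of smooth functions *)

Section smooth_algebra.
Context {R : realType} {n : nat}.
Notation V := 'rV[R]_n.+1.
Implicit Types (x v w : V) (f g F G : V -> R) (O W : set V).

(** [esmooth] concerns all iterated derivatives at once, and the derivative of a product or of a
    composite is not of the same shape again. An induction on the list of directions therefore needs
    a class closed under sums and products. *)
Inductive falg (B : (V -> R) -> Prop) : (V -> R) -> Prop :=
| falg_base f : B f -> falg B f
| falg_cst c : falg B (fun=> c)
| falg_add f g : falg B f -> falg B g -> falg B (fun x => f x + g x)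
| falg_mul f g : falg B f -> falg B g -> falg B (fun x => f x * g x).

Lemma falg_sum (B : (V -> R) -> Prop) (I : Type) (s : seq I) (F : I -> V -> R) :
  (forall i, falg B (F i)) -> falg B (fun x => \sum_(i <- s) F i x).
Proof.
move=> sF; elim: s => [|i s IH].
  have -> : (fun x : V => \sum_(i <- [::]) F i x) = fun=> 0.
    by apply/funext => x; rewrite big_nil.
  exact: falg_cst.
have -> : (fun x : V => \sum_(j <- i :: s) F j x) =
    (fun x => F i x + \sum_(j <- s) F j x).
  by apply/funext => x; rewrite big_cons.
exact: falg_add.
Qed.

(** Derivatives are matched on [O] only, since a formula such as the one for [1 / |x|] holds only
    away from the origin. With [C] distinct from [B], derivatives of generators may be polynomials
    in the generators. *)
Definition derive_closed O (B C : (V -> R) -> Prop) := forall f, B f ->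
  (forall x, O x -> differentiable f x) /\
  (forall v, exists2 g, C g & {in O, 'D_v f =1 g}).

Lemma falg_derive_closed O B : derive_closed O B (falg B) ->
  derive_closed O (falg B) (falg B).
Proof.
move=> HB f; elim=> {f} [f /HB//|c|f g Bf [df Df] Bg [dg Dg]|f g Bf [df Df] Bg [dg Dg]].
- split=> [x _|v]; first exact: differentiable_cst.
  by exists (fun=> 0); [exact: falg_cst|move=> x _; exact: derive_cst].
- split=> [x Ox|v].
    by apply: differentiableD; [exact: df|exact: dg].
  have [f' Af' Ef] := Df v; have [g' Ag' Eg] := Dg v.
  exists (fun x => f' x + g' x); first exact: falg_add.
  move=> x /[dup] Ox; rewrite inE => Ox'; rewrite -Ef// -Eg//.
  by apply: deriveD; apply: diff_derivable; [exact: df|exact: dg].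
- split=> [x Ox|v].
    by apply: differentiableM; [exact: df|exact: dg].
  have [f' Af' Ef] := Df v; have [g' Ag' Eg] := Dg v.
  exists (fun x => f x * g' x + g x * f' x).
    by apply: falg_add; apply: falg_mul.
  move=> x /[dup] Ox; rewrite inE => Ox'; rewrite -Ef// -Eg//.
  by apply: deriveM; apply: diff_derivable; [exact: df|exact: dg].
Qed.

(** Every iterated derivative agrees on [O] with a member of the algebra; openness of [O] lets this
    agreement survive the next derivative. *)
Lemma falg_esmooth O B f : open O -> derive_closed O B (falg B) -> falg B f ->
  esmooth O f.
Proof.
move=> oO /falg_derive_closed HB Bf vs.
suff [g Bg Eg] : exists2 g, falg B g &
    {in O, foldr (fun v (G : V -> R) => 'D_v G) f vs =1 g}.
  move=> x Ox; have [dg _] := HB _ Bg.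
  by apply: (open_eq_differentiable oO Ox _ (dg x Ox)) => y Oy; rewrite Eg.
elim: vs => [|v vs [g Bg Eg]] /=; first by exists f.
have [_ /(_ v)[g' Bg' Eg']] := HB _ Bg; exists g' => // x /[dup] Ox.
by rewrite inE => Ox'; rewrite -Eg'//; exact: (open_eq_derive oO).
Qed.

Lemma esmooth_differentiable O f x : esmooth O f -> O x -> differentiable f x.
Proof. by move=> sf; exact: (sf [::]). Qed.

Lemma esmooth_derive O f v : esmooth O f -> esmooth O ('D_v f).
Proof. by move=> sf vs x Ox; have := sf (rcons vs v) x Ox; rewrite foldr_rcons. Qed.

Lemma esmooth_pd O k f : esmooth O f -> esmooth O (pd k f).
Proof. by rewrite pd.unlock; exact: esmooth_derive. Qed.

Lemma esmooth_falg O f : open O -> falg (esmooth O) f -> esmooth O f.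
Proof.
move=> oO; apply: falg_esmooth => // g sg; split.
  by move=> x Ox; exact: esmooth_differentiable Ox.
by move=> v; exists ('D_v g) => //; apply: falg_base; exact: esmooth_derive.
Qed.

Lemma esmoothD O f g : open O -> esmooth O f -> esmooth O g ->
  esmooth O (fun x => f x + g x).
Proof.
by move=> oO sf sg; apply: esmooth_falg => //; apply: falg_add; exact: falg_base.
Qed.

Lemma esmoothM O f g : open O -> esmooth O f -> esmooth O g ->
  esmooth O (fun x => f x * g x).
Proof.
by move=> oO sf sg; apply: esmooth_falg => //; apply: falg_mul; exact: falg_base.
Qed.

Lemma esmooth_cst O (c : R) : open O -> esmooth O (fun=> c).
Proof. by move=> oO; apply: esmooth_falg => //; exact: falg_cst. Qed.

Lemma esmooth_coord O i : open O -> esmooth O (fun x : V => x 0 i).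
Proof.
move=> oO.
apply: (@falg_esmooth O (fun f => f = fun x : V => x 0 i)) => //; last exact: falg_base.
move=> _ ->; split=> [x _|v]; first exact: differentiable_coord.
by exists (fun=> v 0 i); [exact: falg_cst|move=> x _; exact: deriv_coord].
Qed.

Lemma esmooth_sum O (I : Type) (r : seq I) (F : I -> V -> R) : open O ->
  (forall i, esmooth O (F i)) -> esmooth O (fun x => \sum_(i <- r) F i x).
Proof.
by move=> oO sF; apply: esmooth_falg => //; apply: falg_sum => i; exact: falg_base.
Qed.

Lemma esmooth_eq O f g : open O -> {in O, f =1 g} -> esmooth O f -> esmooth O g.
Proof.
move=> oO fg sf vs x Ox; apply: (open_eq_differentiable oO Ox _ (sf vs x Ox)).
elim: vs => //= v vs IH y; rewrite inE => Oy; exact: (open_eq_derive oO).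
Qed.

End smooth_algebra.

(** * Composition of smooth maps *)

Section composition.
Context {R : realType} {n : nat}.
Notation V := 'rV[R]_n.+1.
Implicit Types (x v w : V) (f g F G : V -> R) (O W : set V).

Lemma differentiable_row (r : V -> V) x :
  (forall i, differentiable (fun y => r y 0 i) x) -> differentiable r x.
Proof.
move=> dr.
have -> : r = \sum_(i < n.+1) (fun y => r y 0 i *: delta_mx 0 i).
  apply/funext => y; rewrite fct_sumE {1}[r y]row_sum_delta.
  by [].
by apply: differentiable_sum => i; exact: differentiableZl.
Qed.

Lemma derive_row (r : V -> V) x v i : differentiable r x ->
  ('D_v r x) 0 i = 'D_v (fun y => r y 0 i) x.
Proof. by move=> dr; rewrite derive_mx ?mxE//; exact: diff_derivable. Qed.

Lemma esmooth_comp O W (r : V -> V) G : open O ->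
  (forall x, O x -> W (r x)) -> (forall i, esmooth O (fun x => r x 0 i)) ->
  esmooth W G -> esmooth O (G \o r).
Proof.
move=> oO OW sr sG.
have dr x : O x -> differentiable r x.
  by move=> Ox; apply: differentiable_row => i; exact: esmooth_differentiable Ox.
(* By the chain rule, the derivative of a pullback [H \o r] is a sum of products of derivatives of
   the coordinates of [r] with pullbacks of partial derivatives of [H], so it stays in the algebra
   of these generators. *)
pose B f := esmooth O f \/ exists2 H, esmooth W H & f = H \o r.
apply: (@falg_esmooth _ _ O B) => //; last by apply: falg_base; right; exists G.
move=> f [sf|[H sH ->]].
  split=> [x Ox|v]; first exact: esmooth_differentiable Ox.
  by exists ('D_v f); [apply: falg_base; left; exact: esmooth_derive|].
have dH x : O x -> differentiable H (r x).
  by move=> /OW Wrx; exact: esmooth_differentiable Wrx.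
split=> [x Ox|v]; first by apply: differentiable_comp; [exact: dr|exact: dH].
exists (fun x => \sum_i 'D_v (fun y => r y 0 i) x * (pd i H \o r) x).
  apply: falg_sum => i; apply: falg_mul; apply: falg_base.
    by left; exact: esmooth_derive.
  by right; exists (pd i H) => //; exact: esmooth_pd.
move=> x; rewrite inE => Ox; rewrite derive_comp; [|exact: dr|exact: dH].
rewrite (derive_sum_pd _ (dH _ Ox)); apply: eq_bigr => i _.
by rewrite derive_row//; exact: dr.
Qed.

End composition.

(** * Euclidean product, norm and radial retraction *)

Section euclidean.
Context {R : realType} {n : nat}.
Notation V := 'rV[R]_n.+1.
Implicit Types (x y z v w : V) (c : R) (O W : set V).

Lemma dotC x y : dot x y = dot y x.
Proof. by apply: eq_bigr => i _; rewrite mulrC. Qed.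

Lemma dotDl x y z : dot (x + y) z = dot x z + dot y z.
Proof. by rewrite -big_split; apply: eq_bigr => i _; rewrite mxE mulrDl. Qed.

Lemma dotZl c x y : dot (c *: x) y = c * dot x y.
Proof. by rewrite /dot mulr_sumr; apply: eq_bigr => i _; rewrite mxE mulrA. Qed.

Lemma dotDr x y z : dot x (y + z) = dot x y + dot x z.
Proof. by rewrite dotC dotDl !(dotC _ x). Qed.

Lemma dotZr c x y : dot x (c *: y) = c * dot x y.
Proof. by rewrite dotC dotZl dotC. Qed.

Lemma dot_delta x i : dot x (delta_mx 0 i) = x 0 i.
Proof.
rewrite /dot (bigD1 i)//= mxE !eqxx mulr1 big1 ?addr0// => j ji.
by rewrite mxE (negbTE ji) andbF mulr0.
Qed.

Lemma dot_ge0 x : 0 <= dot x x.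
Proof. by apply: sumr_ge0 => i _; rewrite -expr2 sqr_ge0. Qed.

Lemma dot_eq0 x : (dot x x == 0) = (x == 0).
Proof.
apply/eqP/eqP => [|->]; last by rewrite /dot big1// => i _; rewrite mxE mul0r.
move=> x0; apply/rowP => i; rewrite mxE.
have := @psumr_eq0P _ _ xpredT (fun i => x 0 i * x 0 i) _ x0 i isT.
by move=> /(_ (fun j _ => sqr_ge0 (x 0 j)))/eqP; rewrite mulf_eq0 orbb => /eqP.
Qed.

Lemma enorm_ge0 x : 0 <= enorm x.
Proof. exact: sqrtr_ge0. Qed.

Lemma sqr_enorm x : enorm x ^+ 2 = dot x x.
Proof. by rewrite sqr_sqrtr// dot_ge0. Qed.

Lemma enorm_gt0 x : (0 < enorm x) = (x != 0).
Proof. by rewrite sqrtr_gt0 lt_neqAle dot_ge0 andbT eq_sym dot_eq0. Qed.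

Lemma enormZ c x : 0 <= c -> enorm (c *: x) = c * enorm x.
Proof.
move=> c0; rewrite /enorm dotZl dotZr mulrA -expr2 sqrtrM ?sqr_ge0//.
by rewrite sqrtr_sqr ger0_norm.
Qed.

Lemma sphere_dot x : sphere x -> dot x x = 1.
Proof. by move=> sx; rewrite -sqr_enorm sx expr1n. Qed.

Lemma retr_sphere x : x != 0 -> sphere (retr x).
Proof.
move=> x0; rewrite /sphere/= /retr enormZ ?invr_ge0 ?enorm_ge0//.
by rewrite mulVf// gt_eqF// enorm_gt0.
Qed.

Lemma retr_id x : sphere x -> retr x = x.
Proof. by move=> sx; rewrite /retr sx invr1 scale1r. Qed.

Lemma retrZ c x : 0 < c -> retr (c *: x) = retr x.
Proof.
move=> c0; rewrite /retr enormZ ?ltW// invfM scalerA mulrAC mulVf ?mul1r//.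
by rewrite gt_eqF.
Qed.

Lemma cauchy_schwarz x y : (dot x y) ^+ 2 <= dot x x * dot y y.
Proof.
have [->|y0] := eqVneq y 0.
  by rewrite -[0 : V](scale0r (0 : V)) !dotZr !mul0r !mulr0 expr0n.
have yy : 0 < dot y y by rewrite lt_neqAle dot_ge0 eq_sym dot_eq0 y0.
(* This vector is [dot y y] times the component of [x] orthogonal to [y]; its square is [dot y y]
   times the gap in the inequality. *)
have := dot_ge0 (dot y y *: x + - dot x y *: y).
rewrite !(dotDl, dotDr, dotZl, dotZr) (dotC y x) => H.
rewrite -subr_ge0 -(pmulr_rge0 _ yy); apply: (le_trans H).
by rewrite le_eqVlt; apply/orP; left; apply/eqP; ring.
Qed.

Lemma esmooth_dot O : open O -> esmooth O (fun x => dot x x).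
Proof.
move=> oO; apply: esmooth_sum => // i.
by apply: esmoothM => //; exact: esmooth_coord.
Qed.

Lemma derive_dot x v : 'D_v (fun x => dot x x) x = 2 * dot x v.
Proof.
have -> : (fun x => dot x x) = \sum_(i < n.+1) (fun y : V => y 0 i * y 0 i).
  by apply/funext => y; rewrite fct_sumE.
have dc i : derivable (fun y : V => y 0 i) x v.
  exact/diff_derivable/differentiable_coord.
rewrite derive_sum => [|i]; last exact: derivableM.
rewrite mulr_sumr; apply: eq_bigr => i _.
rewrite deriveM// deriv_coord; rewrite /GRing.scale/=; ring.
Qed.

Lemma differentiable_enorm x : x != 0 -> differentiable (@enorm R n.+1) x.
Proof.
move=> x0; apply: differentiable_comp.
  exact: (esmooth_differentiable (esmooth_dot openT)).
apply/derivable1_diffP.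
have d0 : 0 < dot x x by rewrite -sqr_enorm exprn_gt0// enorm_gt0.
by have [] := is_derive1_sqrt d0.
Qed.

Lemma derive_enorm x v : x != 0 -> 'D_v (@enorm R n.+1) x = dot x v / enorm x.
Proof.
move=> x0; have dN : derivable (@enorm R n.+1) x v.
  exact/diff_derivable/differentiable_enorm.
have E : (@enorm R n.+1 * @enorm R n.+1)%R = (fun x => dot x x).
  by apply/funext => y; rewrite -sqr_enorm expr2.
have := deriveM dN dN; rewrite E derive_dot /GRing.scale/=.
have N0 : enorm x != 0 by rewrite gt_eqF// enorm_gt0.
by move=> H; apply: (mulIf N0); rewrite divfK//; lra.
Qed.

Lemma esmooth_inv_enorm O : open O -> (forall x, O x -> x != 0) ->
  esmooth O (fun x => (enorm x)^-1).
Proof.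
move=> oO O0; pose M x := (enorm x)^-1.
pose B f := esmooth O f \/ f = M.
apply: (@falg_esmooth _ _ O B) => //; last by apply: falg_base; right.
move=> f [sf| ->].
  split=> [x Ox|v]; first exact: esmooth_differentiable Ox.
  by exists ('D_v f); [apply: falg_base; left; exact: esmooth_derive|].
have nz x : O x -> enorm x != 0 by move=> /O0 x0; rewrite gt_eqF// enorm_gt0.
split=> [x Ox|v].
  by apply: differentiableV; [apply: differentiable_enorm; exact: O0|exact: nz].
(* The derivative of [1 / |x|] along [v] is [- dot x v / |x|^3], a polynomial in [M] and the
   coordinates. *)
exists (fun x => M x * M x * M x * (\sum_i x 0 i * - v 0 i)).
  have AM : falg B M by apply: falg_base; right.
  apply: falg_mul; first by do 2?apply: falg_mul.
  apply: falg_sum => i; apply: falg_mul; last exact: falg_cst.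
  by apply: falg_base; left; exact: esmooth_coord.
move=> x; rewrite inE => Ox.
have := nz x Ox; have x0 := O0 x Ox => N0.
rewrite deriveV//; last exact/diff_derivable/differentiable_enorm.
rewrite derive_enorm// /M /dot.
under [in RHS]eq_bigr do rewrite mulrN.
by rewrite sumrN /GRing.scale/=; field.
Qed.

Lemma esmooth_retr O i : open O -> (forall x, O x -> x != 0) ->
  esmooth O (fun x => retr x 0 i).
Proof.
move=> oO O0.
have -> : (fun x : V => retr x 0 i) = (fun x => (enorm x)^-1 * x 0 i).
  by apply/funext => x; rewrite mxE.
by apply: esmoothM => //; [exact: esmooth_inv_enorm|exact: esmooth_coord].
Qed.

End euclidean.

(** * The Euclidean Laplacian and the rotation fields *)

Section laplacian.
Context {R : realType} {n : nat}.
Notation V := 'rV[R]_n.+1.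
Implicit Types (x v : V) (f g F G : V -> R) (i j k : 'I_n.+1).
Context (O : set V).
Hypothesis openO : open O.

Lemma derive_bigsum (I : Type) (r : seq I) (F : I -> V -> R) x v :
  (forall a, differentiable (F a) x) ->
  'D_v (fun y => \sum_(a <- r) F a y) x = \sum_(a <- r) 'D_v (F a) x.
Proof.
move=> dF.
suff [] : differentiable (fun y => \sum_(a <- r) F a y) x /\
  'D_v (fun y => \sum_(a <- r) F a y) x = \sum_(a <- r) 'D_v (F a) x by [].
elim: r => [|a r [dr IH]].
  have -> : (fun y : V => \sum_(a <- [::]) F a y) = cst 0.
    by apply/funext => y; rewrite big_nil.
  by rewrite derive_cst big_nil; split => //; exact: differentiable_cst.
have -> : (fun y : V => \sum_(b <- a :: r) F b y) =
    F a + (fun y => \sum_(b <- r) F b y).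
  by apply/funext => y; rewrite big_cons.
split; first exact: differentiableD.
by rewrite deriveD ?big_cons ?IH//; exact: diff_derivable.
Qed.

Lemma pd_eq k F G x : O x -> {in O, F =1 G} -> pd k F x = pd k G x.
Proof. by rewrite pd.unlock; exact: open_eq_derive. Qed.

Lemma pd_comm i j F x : esmooth O F -> O x ->
  pd i (pd j F) x = pd j (pd i F) x.
Proof.
move=> sF Ox; rewrite pd.unlock; apply: (derive_comm openO Ox).
- move=> y Oy; split; apply: esmooth_differentiable Oy => //;
    exact: esmooth_derive.
- apply: differentiable_continuous.
  by apply: esmooth_differentiable Ox; do 2!apply: esmooth_derive.
- apply: differentiable_continuous.
  by apply: esmooth_differentiable Ox; do 2!apply: esmooth_derive.
Qed.

Lemma pdB k F G x : esmooth O F -> esmooth O G -> O x ->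
  pd k (fun y => F y - G y) x = pd k F x - pd k G x.
Proof.
by move=> sF sG Ox; rewrite pd.unlock; apply: deriveB; apply: diff_derivable;
  exact: esmooth_differentiable Ox.
Qed.

Lemma pdM k F G x : esmooth O F -> esmooth O G -> O x ->
  pd k (fun y => F y * G y) x = F x * pd k G x + G x * pd k F x.
Proof.
by move=> sF sG Ox; rewrite pd.unlock; apply: deriveM; apply: diff_derivable;
  exact: esmooth_differentiable Ox.
Qed.

Lemma pdD k F G x : esmooth O F -> esmooth O G -> O x ->
  pd k (fun y => F y + G y) x = pd k F x + pd k G x.
Proof.
by move=> sF sG Ox; rewrite pd.unlock; apply: deriveD; apply: diff_derivable;
  exact: esmooth_differentiable Ox.
Qed.

Lemma pd_bigsum k (I : Type) (r : seq I) (F : I -> V -> R) x :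
  (forall a, esmooth O (F a)) -> O x ->
  pd k (fun y => \sum_(a <- r) F a y) x = \sum_(a <- r) pd k (F a) x.
Proof.
by move=> sF Ox; rewrite pd.unlock; apply: derive_bigsum => a; exact: esmooth_differentiable Ox.
Qed.

Definition lap F : V -> R := fun x => \sum_k pd k (pd k F) x.

Lemma lap_eq F G x : O x -> {in O, F =1 G} -> lap F x = lap G x.
Proof.
move=> Ox FG; apply: eq_bigr => k _; apply: pd_eq => // y.
by rewrite inE => Oy; exact: pd_eq.
Qed.

Lemma lap_sum (I : Type) (r : seq I) (F : I -> V -> R) x :
  (forall a, esmooth O (F a)) -> O x ->
  lap (fun y => \sum_(a <- r) F a y) x = \sum_(a <- r) lap (F a) x.
Proof.
move=> sF Ox; rewrite /lap exchange_big; apply: eq_bigr => k _ /=.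
have E : {in O, pd k (fun y => \sum_(a <- r) F a y) =1
    fun y => \sum_(a <- r) pd k (F a) y}.
  move=> y; rewrite inE => Oy; exact: pd_bigsum.
rewrite (pd_eq k Ox E); apply: pd_bigsum => // a.
exact: esmooth_pd.
Qed.

Lemma lapB F G x : esmooth O F -> esmooth O G -> O x ->
  lap (fun y => F y - G y) x = lap F x - lap G x.
Proof.
move=> sF sG Ox; rewrite /lap -sumrB; apply: eq_bigr => k _.
rewrite -(pdB k (esmooth_pd k sF) (esmooth_pd k sG) Ox).
by apply: pd_eq => // y; rewrite inE => Oy; exact: pdB.
Qed.

Lemma lapM F G x : esmooth O F -> esmooth O G -> O x ->
  lap (fun y => F y * G y) x =
  F x * lap G x + G x * lap F x + 2 * \sum_k pd k F x * pd k G x.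
Proof.
move=> sF sG Ox; rewrite /lap !mulr_sumr -!big_split; apply: eq_bigr => k _ /=.
have sk H : esmooth O H -> esmooth O (pd k H) by exact: esmooth_pd.
have E : {in O, pd k (fun y => F y * G y) =1
    fun y => F y * pd k G y + G y * pd k F y}.
  by move=> y; rewrite inE => Oy; exact: pdM.
rewrite (pd_eq k Ox E) pdD//; last 2 first.
- by apply: esmoothM => //; exact: sk.
- by apply: esmoothM => //; exact: sk.
rewrite (pdM k sF (sk _ sG) Ox) (pdM k sG (sk _ sF) Ox).
ring.
Qed.

Lemma lap_coord i x : lap (fun y : V => y 0 i) x = 0.
Proof.
rewrite /lap big1// => k _.
have -> : pd k (fun y : V => y 0 i) = cst (k == i)%:R.
  by apply/funext => y; exact: pd_coord.
exact: pd_cst.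
Qed.

Lemma lap_coordM i G x : esmooth O G -> O x ->
  lap (fun y => y 0 i * G y) x = x 0 i * lap G x + 2 * pd i G x.
Proof.
move=> sG Ox; rewrite lapM//; last exact: esmooth_coord.
rewrite lap_coord mulr0 addr0 (bigD1 i)//= pd_coord eqxx mul1r big1 ?addr0//.
by move=> k ki; rewrite pd_coord (negbTE ki) mul0r.
Qed.

Lemma lap_pd i F x : esmooth O F -> O x -> lap (pd i F) x = pd i (lap F) x.
Proof.
move=> sF Ox; have skk k : esmooth O (pd k (pd k F)) by do 2!apply: esmooth_pd.
rewrite /lap pd_bigsum//; apply: eq_bigr => k _.
rewrite [RHS](pd_comm _ _ (esmooth_pd k sF) Ox).
by apply: pd_eq => // y; rewrite inE => Oy; exact: pd_comm.
Qed.

(* The rotation field in the (i, j)-plane, which is a Killing field of the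
   sphere and hence commutes with the Laplacian. *)
Definition rot i j F : V -> R := fun x => x 0 i * pd j F x - x 0 j * pd i F x.

Lemma esmooth_rot i j F : esmooth O F -> esmooth O (rot i j F).
Proof.
move=> sF.
have sxp a b : esmooth O (fun x => x 0 a * pd b F x).
  by apply: esmoothM => //; [exact: esmooth_coord|exact: esmooth_pd].
have -> : rot i j F = fun x => x 0 i * pd j F x + (-1) * (x 0 j * pd i F x).
  by apply/funext => x; rewrite mulN1r.
by apply: esmoothD => //; apply: esmoothM => //; exact: esmooth_cst.
Qed.

(** The partial derivatives of [F] are harmonic, and a linear coefficient [x_i] contributes only the
    cross term [2 d_i]. What remains is [2 (d_i d_j F - d_j d_i F)], zero by symmetry. *)
Lemma lap_rot i j F x : esmooth O F -> {in O, lap F =1 fun=> 0} -> O x ->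
  lap (rot i j F) x = 0.
Proof.
move=> sF lF Ox.
have sxp a b : esmooth O (fun x => x 0 a * pd b F x).
  by apply: esmoothM => //; [exact: esmooth_coord|exact: esmooth_pd].
rewrite lapB// !lap_coordM//; try exact: esmooth_pd.
have l0 a : lap (pd a F) x = 0.
  by rewrite lap_pd// (pd_eq a Ox lF); exact: pd_cst.
by rewrite !l0 (pd_comm i j sF Ox); ring.
Qed.

End laplacian.

(** * Homogeneous functions on a cone and Euler's identities *)

Section homogeneous.
Context {R : realType} {n : nat}.
Notation V := 'rV[R]_n.+1.
Implicit Types (x v : V) (f g F G : V -> R) (i j k : 'I_n.+1) (c : R).
Context (O : set V).
Hypothesis openO : open O.
Hypothesis coneO : forall c x, 0 < c -> O x -> O (c *: x).

Definition homogeneous0 F := forall c x, 0 < c -> O x -> F (c *: x) = F x.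

Definition homogeneousV F :=
  forall c x, 0 < c -> O x -> F (c *: x) = c^-1 * F x.

Lemma derive_scale c x v : 'D_v (fun y : V => c *: y) x = c *: v.
Proof.
have d := is_diff_scaler c x.
by rewrite deriveE ?diff_val//; exact: ex_diff.
Qed.

(** Both sides of [F (c *: x) = s c * F x] are differentiated in [x]. A general factor [s] covers
    degrees 0 and -1, and so two successive derivatives of a function of degree 0. *)
Lemma pd_homogeneous (s : R -> R) k F : esmooth O F ->
  (forall c x, 0 < c -> O x -> F (c *: x) = s c * F x) ->
  forall c x, 0 < c -> O x -> pd k F (c *: x) = c^-1 * (s c * pd k F x).
Proof.
move=> sF hF c x c0 Ox; rewrite pd.unlock; set v := delta_mx 0 k.
have Ocx := coneO c0 Ox.
have dF := esmooth_differentiable sF Ocx.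
have dc : differentiable (fun y : V => c *: y) x.
  by have d := is_diff_scaler c x; exact: ex_diff.
have E := derive_comp v dc dF.
rewrite derive_scale (derive_scaler _ _ dF) in E.
have E' : s c * 'D_v F x = 'D_v (F \o (fun y : V => c *: y)) x.
  have dFx := diff_derivable (esmooth_differentiable sF Ox).
  rewrite -[LHS](deriveZ (s c) (dFx v)).
  have FO : {in O, s c *: F =1 F \o (fun y : V => c *: y)}.
    by move=> y; rewrite inE => Oy; rewrite /= hF.
  exact: (open_eq_derive openO v Ox FO).
by rewrite E' E mulKf// gt_eqF.
Qed.

Lemma homogeneousV_pd k F : esmooth O F -> homogeneous0 F ->
  homogeneousV (pd k F).
Proof.
move=> sF hF c x c0 Ox; rewrite (@pd_homogeneous (fun=> 1))// ?mul1r//.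
by move=> d y d0 Oy; rewrite mul1r hF.
Qed.

Lemma lap_homogeneous F c x : esmooth O F -> homogeneous0 F -> 0 < c -> O x ->
  lap F (c *: x) = c^-1 * (c^-1 * lap F x).
Proof.
move=> sF hF c0 Ox; rewrite /lap !mulr_sumr; apply: eq_bigr => k _.
rewrite (@pd_homogeneous (fun c => c^-1) k (pd k F))//; first exact: esmooth_pd.
exact: homogeneousV_pd.
Qed.

Lemma is_derive_ray F x : differentiable F x ->
  is_derive (0 : R) 1 (fun r : R => F ((1 + r) *: x)) ('D_x F x).
Proof.
move=> dF.
have -> : (fun r : R => F ((1 + r) *: x)) = fun r => F (x + r *: x).
  by apply/funext => r; rewrite scalerDl scale1r.
have e0 : x + (0 : R) *: x = x by rewrite scale0r addr0.
have := @is_derive_line _ _ F x x 0; rewrite e0; exact.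
Qed.

Lemma near0_1D : \forall r \near (0 : R), 0 < 1 + r.
Proof.
near=> r; rewrite -ltrBlDl sub0r.
by near: r; apply: lt_nbhsr; rewrite oppr_lt0.
Unshelve. all: by end_near. Qed.

(** The sum is the derivative of [F] along the ray through [x], on which [F] is constant. The ray is
    parametrized as [(1 + r) *: x], so homogeneity applies for [r] near 0. *)
Lemma euler0 F x : esmooth O F -> homogeneous0 F -> O x ->
  \sum_k x 0 k * pd k F x = 0.
Proof.
move=> sF hF Ox; have dF := esmooth_differentiable sF Ox.
rewrite -derive_sum_pd//.
have dl := is_derive_ray dF.
have dl' : is_derive (0 : R) 1 (fun=> F x) ('D_x F x).
  apply: near_eq_is_derive dl.
  by apply: filterS near0_1D => r r0; exact: hF.
by rewrite -(derive_val (is_derive := dl')) derive_cst.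
Qed.

Lemma eulerV F x : esmooth O F -> homogeneousV F -> O x ->
  \sum_k x 0 k * pd k F x = - F x.
Proof.
move=> sF hF Ox; have dF := esmooth_differentiable sF Ox.
rewrite -derive_sum_pd//.
have dl := is_derive_ray dF.
have dl' : is_derive (0 : R) 1 (fun r => (1 + r)^-1 * F x) ('D_x F x).
  apply: near_eq_is_derive dl.
  by apply: filterS near0_1D => r r0; exact: hF.
have d1 : is_derive (0 : R) 1 (fun r : R => 1 + r) 1.
  have d := is_deriveD (is_derive_cst (1 : R) (0 : R) 1) (is_derive_id (0 : R) 1).
  by apply: (is_derive_eq d); rewrite add0r.
have d2 : is_derive (0 : R) 1 (fun r : R => (1 + r)^-1 * F x) (- F x).
  have n0 : (1 + 0 : R) != 0 by rewrite addr0 oner_neq0.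
  have dV := is_deriveV (f := fun r : R => 1 + r) n0 d1.
  have dM := is_deriveM dV (is_derive_cst (F x) (0 : R) 1).
  apply: (is_derive_eq dM).
  by rewrite addr0 /GRing.scale/= mulr0 add0r expr1n invr1 mulr1 mulrN1.
by rewrite -(derive_val (is_derive := dl')) (derive_val (is_derive := d2)).
Qed.

Lemma homogeneous0_rot i j F : esmooth O F -> homogeneous0 F ->
  homogeneous0 (rot i j F).
Proof.
move=> sF hF c x c0 Ox; have c1 : c != 0 by rewrite gt_eqF.
rewrite /rot !(homogeneousV_pd _ sF hF c0 Ox) !mxE.
by field.
Qed.

(** Lagrange's identity for [x] and the gradient of [F]: the cross terms add up to a multiple of the
    square of [sum_k x_k d_k F], which is 0 by [euler0]. *)
Lemma sum_rot_sqr F x : esmooth O F -> homogeneous0 F -> O x ->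
  \sum_i \sum_j rot i j F x ^+ 2 = 2 * dot x x * \sum_k pd k F x ^+ 2.
Proof.
move=> sF hF Ox; have e0 := euler0 sF hF Ox.
pose p k := pd k F x.
have -> : \sum_i \sum_j rot i j F x ^+ 2 =
  \sum_i \sum_j (x 0 i * x 0 i * p j ^+ 2 + p i ^+ 2 * (x 0 j * x 0 j)) -
  2 * \sum_i \sum_j (x 0 i * p i) * (x 0 j * p j).
  rewrite mulr_sumr -sumrB; apply: eq_bigr => i _.
  rewrite mulr_sumr -sumrB; apply: eq_bigr => j _.
  by rewrite /rot -/(p i) -/(p j); ring.
have -> : \sum_i \sum_j (x 0 i * p i) * (x 0 j * p j) = 0.
  by rewrite big1// => i _; rewrite -mulr_sumr e0 mulr0.
rewrite mulr0 subr0.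
under eq_bigr do rewrite big_split -mulr_sumr -mulr_sumr.
by rewrite big_split -!mulr_suml /= /dot; ring.
Qed.

Lemma lap_sqr F x : esmooth O F -> homogeneous0 F ->
  {in O, lap F =1 fun=> 0} -> O x ->
  dot x x * lap (fun y => F y * F y) x = \sum_i \sum_j rot i j F x ^+ 2.
Proof.
move=> sF hF lF Ox; rewrite (lapM openO sF sF Ox) lF ?inE// sum_rot_sqr//.
have -> : \sum_k pd k F x * pd k F x = \sum_k pd k F x ^+ 2.
  by apply: eq_bigr => k _; rewrite expr2.
by ring.
Qed.

End homogeneous.

(** * The Laplace-Beltrami operator as a Euclidean Laplacian *)

Section laplace_beltrami.
Context {R : realType} {n : nat}.
Notation V := 'rV[R]_n.+1.
Implicit Types (x y p v : V) (f : V -> R) (i j k : 'I_n.+1) (c : R).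
Context (O : set V).
Hypothesis openO : open O.
Hypothesis coneO : forall c x, 0 < c -> O x -> O (c *: x).
Hypothesis O_neq0 : forall x, O x -> x != 0.

Lemma homogeneous0_retr f : homogeneous0 O (f \o @retr R n).
Proof. by move=> c x c0 Ox; rewrite /= retrZ. Qed.

Lemma tproj_dot p v : sphere p -> dot p (tproj p v) = 0.
Proof.
by move=> sp; rewrite /tproj -scaleNr dotDr dotZr sphere_dot// (dotC p v); ring.
Qed.

Lemma tproj_coord p v i : tproj p v 0 i = v 0 i - dot v p * p 0 i.
Proof. by rewrite /tproj !mxE. Qed.

Lemma derive_tproj f x p i : differentiable f x ->
  'D_(tproj p (delta_mx 0 i)) f x = pd i f x - p 0 i * \sum_k p 0 k * pd k f x.
Proof.
move=> df; rewrite /tproj -scaleNr derive_addr// derive_scaler//.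
rewrite dotC dot_delta -(derive_sum_pd p df) mulNr.
by rewrite pd.unlock.
Qed.

Lemma cone_retr x : O x -> O (retr x).
Proof.
by move=> Ox; apply: coneO => //; rewrite invr_gt0 enorm_gt0; exact: O_neq0.
Qed.

Variable f : V -> R.
Local Notation F := (f \o @retr R n).
Hypothesis smoothF : esmooth O F.

(** The correction made by the tangential projection is a multiple of the Euler sum of [F], so it
    vanishes. *)
Lemma sgradE x : O x -> sphere x -> sgrad f x = \row_i pd i F x.
Proof.
move=> Ox sx; apply/rowP => i; rewrite !mxE /sdiff derive_tproj.
  by rewrite (euler0 smoothF (@homogeneous0_retr f) Ox) mulr0 subr0.
exact: esmooth_differentiable smoothF Ox.
Qed.

(** The left side has degree 0 and [pd i F] has degree -1; [enorm x] makes up the difference. *)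
Lemma sgrad_retr x i : O x -> sgrad f (retr x) 0 i = enorm x * pd i F x.
Proof.
move=> Ox; have x0 := O_neq0 Ox; have N0 : 0 < enorm x by rewrite enorm_gt0.
rewrite (sgradE (cone_retr Ox) (retr_sphere x0)) mxE {1}/retr.
rewrite (homogeneousV_pd openO coneO i smoothF (@homogeneous0_retr f) _ Ox).
  by rewrite invrK.
by rewrite invr_gt0.
Qed.

(** The factor [enorm] of [sgrad_retr] has zero derivative in tangent directions. The second summand
    comes from the projection of the direction: by [eulerV], the radial derivative of [pd j F] is
    [- pd j F]. *)
Lemma sdiff_sgrad p i j : O p -> sphere p ->
  sdiff (sgrad f) p (tproj p (delta_mx 0 i)) 0 j =
  pd i (pd j F) p + p 0 i * pd j F p.
Proof.
move=> Op sp; have p0 := O_neq0 Op.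
pose r x : V := \row_k (enorm x * pd k F x).
have sgr : {in O, sgrad f \o @retr R n =1 r}.
  by move=> x; rewrite inE => Ox; apply/rowP => k; rewrite [RHS]mxE; exact: sgrad_retr.
have dN := differentiable_enorm p0.
have spd k : esmooth O (pd k F) by exact: esmooth_pd.
have dpd k := esmooth_differentiable (spd k) Op.
have rE k : (fun x => r x 0 k) = (@enorm R n.+1 * pd k F)%R.
  by apply/funext => x; rewrite mxE.
have dr : differentiable r p.
  by apply: differentiable_row => k; rewrite rE; exact: differentiableM.
rewrite /sdiff (open_eq_derive openO _ Op sgr) derive_row// rE.
rewrite deriveM; [|exact: diff_derivable|exact: diff_derivable].
rewrite derive_enorm// tproj_dot// mul0r scaler0 addr0 sp scale1r.
rewrite derive_tproj// (eulerV (spd j) _ Op); first by rewrite mulrN opprK.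
exact: (homogeneousV_pd openO coneO j smoothF (@homogeneous0_retr f)).
Qed.

(** By [euler0] the trace of [H] is [lap F p]. The part subtracted by the outer projection is the
    value of [H] on the pair [(p, p)]; there the second summand of [H] cancels the radial derivative
    of [pd j F] for each [j]. *)
Lemma laplace_beltramiE p : O p -> sphere p -> laplace_beltrami f p = lap F p.
Proof.
move=> Op sp.
have e0 := euler0 smoothF (@homogeneous0_retr f) Op.
pose H i j := pd i (pd j F) p + p 0 i * pd j F p.
have -> : laplace_beltrami f p =
    \sum_i (H i i - (\sum_j H i j * p 0 j) * p 0 i).
  apply: eq_bigr => i _; rewrite mxE /snabla tproj_coord sdiff_sgrad//; congr (_ - _ * _).
  by apply: eq_bigr => j _; rewrite sdiff_sgrad.
rewrite sumrB big_split /= e0 addr0.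
under [X in _ - X]eq_bigr do rewrite mulr_suml.
rewrite [X in _ - X]exchange_big /= [X in _ - X]big1 ?subr0// => j _.
have -> : \sum_i H i j * p 0 j * p 0 i =
    p 0 j * (\sum_i p 0 i * pd i (pd j F) p) + p 0 j * pd j F p * dot p p.
  rewrite /dot !mulr_sumr -big_split; apply: eq_bigr => i _ /=.
  by rewrite /H; ring.
rewrite sphere_dot// (eulerV _ _ Op); [ring|exact: esmooth_pd|].
exact: (homogeneousV_pd openO coneO j smoothF (@homogeneous0_retr f)).
Qed.

End laplace_beltrami.

(** * Invariance of sums of squares of harmonic functions *)

Section sum_of_squares.
Context {R : realType} {n : nat}.
Notation V := 'rV[R]_n.+1.
Implicit Types (x y p v : V) (f : V -> R) (i j k : 'I_n.+1) (c : R).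
Context (O : set V).
Hypothesis openO : open O.
Hypothesis coneO : forall c x, 0 < c -> O x -> O (c *: x).
Hypothesis O_neq0 : forall x, O x -> x != 0.

(* On the part of the sphere in the cone [O], [f] is a finite sum of squares
   of harmonic functions, extended to [O] with homogeneity degree 0. *)
Definition harmonic_sos f := exists (I : finType) (G : I -> V -> R),
  (forall a, [/\ esmooth O (G a), homogeneous0 O (G a) &
                 {in O, lap (G a) =1 fun=> 0}]) /\
  (forall x, O x -> f (retr x) = \sum_a G a x * G a x).

Lemma homogeneous0_retrE F x : homogeneous0 O F -> O x -> F (retr x) = F x.
Proof.
by move=> hF Ox; apply: hF => //; rewrite invr_gt0 enorm_gt0; exact: O_neq0.
Qed.

Lemma harmonic_sos_laplace_beltrami f :
  harmonic_sos f -> harmonic_sos (laplace_beltrami f).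
Proof.
move=> [I [G [hG fE]]].
(* Summing over ordered pairs absorbs the factor 2 in front of the squared gradient. *)
exists (I * ('I_n.+1 * 'I_n.+1))%type, (fun t => rot t.2.1 t.2.2 (G t.1)).
split=> [[a [i j]]|x Ox] /=.
  have [sG h0 lG] := hG a; split.
  - exact: esmooth_rot.
  - exact: (homogeneous0_rot openO coneO i j sG h0).
  - by move=> x; rewrite inE => Ox; exact: (lap_rot openO i j sG lG Ox).
have sGG a : esmooth O (fun y => G a y * G a y).
  by have [sG _ _] := hG a; exact: esmoothM.
have sqE : {in O, (fun y => \sum_a G a y * G a y) =1 f \o @retr R n}.
  by move=> y; rewrite inE => Oy; rewrite /= fE.
have sf : esmooth O (f \o @retr R n).
  by apply: (esmooth_eq openO sqE); exact: esmooth_sum.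
have Orx := cone_retr coneO O_neq0 Ox.
have srx := retr_sphere (O_neq0 Ox).
rewrite (laplace_beltramiE openO coneO O_neq0 sf Orx srx).
rewrite -(lap_eq openO Orx sqE) (lap_sum openO _ sGG Orx).
rewrite -(pair_bigA _ (fun a t => rot t.1 t.2 (G a) x * rot t.1 t.2 (G a) x)).
apply: eq_bigr => a _; have [sG h0 lG] := hG a.
rewrite -(pair_bigA _ (fun i j => rot i j (G a) x * rot i j (G a) x)) /=.
(* The factor [dot] required by [lap_sqr] is 1 at [retr x]; the rotated functions are then carried
   back to [x] by homogeneity. *)
rewrite -[LHS]mul1r -(sphere_dot srx) (lap_sqr openO sG h0 lG Orx).
apply: eq_bigr => i _; apply: eq_bigr => j _.
rewrite (homogeneous0_retrE _ Ox) ?expr2//.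
exact: (homogeneous0_rot openO coneO i j sG h0).
Qed.

Lemma harmonic_sos_ge0 f x : harmonic_sos f -> O x -> sphere x -> 0 <= f x.
Proof.
move=> [I [G [_ fE]]] Ox sx; rewrite -(retr_id sx) fE//.
by apply: sumr_ge0 => a _; rewrite -expr2 sqr_ge0.
Qed.

Lemma harmonic_sos_iter f x m : harmonic_sos f -> O x -> sphere x ->
  0 <= iter m (@laplace_beltrami R n) f x.
Proof.
move=> sf Ox sx; apply: harmonic_sos_ge0 => //.
by elim: m => //= m; exact: harmonic_sos_laplace_beltrami.
Qed.

Lemma harmonic_sos_sqr h : esmooth O (h \o @retr R n) ->
  (forall x, O x -> sphere x -> laplace_beltrami h x = 0) ->
  harmonic_sos (fun x => `|h x| ^+ 2).
Proof.
move=> sh lh; exists unit, (fun=> h \o @retr R n); split=> [_|x Ox]; last first.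
  by rewrite big_const card_unit /= addr0 -expr2 real_normK// num_real.
have h0 := @homogeneous0_retr _ _ O h.
split => // x; rewrite inE => Ox.
have x0 := O_neq0 Ox; have N0 : 0 < enorm x by rewrite enorm_gt0.
have Orx := cone_retr coneO O_neq0 Ox; have srx := retr_sphere x0.
(* Harmonicity of [h] is known on the sphere only; degree -2 of the Laplacian spreads it along
   rays. *)
have -> : x = enorm x *: retr x by rewrite /retr scalerA divff ?scale1r// gt_eqF.
rewrite (lap_homogeneous openO coneO sh h0 N0 Orx).
by rewrite -(laplace_beltramiE openO coneO O_neq0 sh Orx srx) lh// !mulr0.
Qed.

End sum_of_squares.

(** * The cone over a geodesic ball *)

Section ball_cone.
Context {R : realType} {n : nat}.
Notation V := 'rV[R]_n.+1.
Implicit Types (x y q : V) (U W : set V).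
Context (q : V) (rho : R).
Hypotheses (sphereq : sphere q) (rho_gt0 : 0 < rho) (rho_ltpi : rho < pi).

(** Free of [acos] and of division by the norm, this form makes openness and invariance under
    positive scaling direct; the strict inequality excludes the origin. *)
Definition ball_cone : set V := [set x | cos rho * enorm x < dot x q].

(** The cosine is strictly decreasing on [[0, pi]], which contains [rho]; Cauchy-Schwarz places
    [dot x q] in [[-1, 1]], where [cos] inverts [acos]. *)
Lemma ball_cone_sphere x : sphere x -> ball_cone x <-> geodesic_ball q rho x.
Proof.
move=> sx; rewrite /ball_cone /geodesic_ball /= (_ : enorm x = 1)// mulr1.
have d1 : -1 <= dot x q <= 1.
  rewrite -ler_norml -(@ler_pXn2r _ 2)// ?nnegrE// real_normK ?num_real//.
  by have := cauchy_schwarz x q; rewrite !sphere_dot// mulr1 expr1n.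
have acosd : acos (dot x q) \in `[0, pi].
  by rewrite in_itv/= acos_ge0// acos_lepi.
have rhoI : rho \in `[0, pi] by rewrite in_itv/= !ltW.
have := ltr_cos acosd rhoI; rewrite acosK; last by rewrite in_itv.
by move=> ->; split=> [|[]].
Qed.

Lemma ball_cone_scale (c : R) x : 0 < c -> ball_cone x -> ball_cone (c *: x).
Proof.
move=> c0; rewrite /ball_cone/= enormZ ?ltW// dotZl mulrCA.
by rewrite ltr_pM2l.
Qed.

Lemma ball_cone_neq0 x : ball_cone x -> x != 0.
Proof.
apply: contraPneq => ->; rewrite /ball_cone/= -(scale0r (0 : V)).
by rewrite enormZ// dotZl !mul0r mulr0 ltxx.
Qed.

Lemma continuous_enorm : continuous (@enorm R n.+1).
Proof.
move=> x; apply: continuous_comp; last exact: sqrt_continuous.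
apply: differentiable_continuous.
exact: (esmooth_differentiable (esmooth_dot openT)).
Qed.

Lemma open_ball_cone : open ball_cone.
Proof.
have -> : ball_cone = (fun x => dot x q - cos rho * enorm x) @^-1` [set r | 0 < r].
  by apply/seteqP; split=> x; rewrite /ball_cone/= subr_gt0.
apply: open_comp; last exact: open_gt.
move=> x _.
have dc : {for x, continuous (fun y => dot y q)}.
  apply: differentiable_continuous.
  apply: (@esmooth_differentiable _ _ setT) => //.
  apply: esmooth_sum => [|i]; first exact: openT.
  apply: esmoothM; first exact: openT.
    by apply: esmooth_coord; exact: openT.
  by apply: esmooth_cst; exact: openT.
have dn : {for x, continuous (fun y => cos rho * enorm y)}.
  have cN : {for x, continuous (@enorm R n.+1)} by exact: continuous_enorm.
  have cc : {for x, continuous (fun _ : V => cos rho)} by exact: cst_continuous.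
  exact: (continuousM cc cN).
exact: (continuousB dc dn).
Qed.

(** [smooth_on] supplies an extension [F] that depends on the point. Since [esmooth] is tested point
    by point, it is enough to replace [h \o retr] by [F \o retr] near each point of the cone, with
    no gluing. *)
Lemma esmooth_retr_ball h : smooth_on (geodesic_ball q rho) h ->
  esmooth ball_cone (h \o @retr R n).
Proof.
move=> sh.
have oC := open_ball_cone; have C0 := ball_cone_neq0.
have Cb x : ball_cone x -> geodesic_ball q rho (retr x).
  move=> Cx; apply/ball_cone_sphere; first by apply: retr_sphere; exact: C0.
  by apply: cone_retr Cx => //; exact: ball_cone_scale.
suff loc x : ball_cone x -> exists O,
    [/\ open O, O x & esmooth O (h \o @retr R n)].
  by move=> vs x Cx; have [U [_ Ux sU]] := loc x Cx; exact: sU.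
move=> Cx; have [W [F [oW Wx sF hF]]] := sh _ (Cb x Cx).
pose O := ball_cone `&` @retr R n @^-1` W.
have dr y : ball_cone y -> differentiable (@retr R n) y.
  move=> Cy; apply: differentiable_row => i.
  by apply: (esmooth_differentiable (esmooth_retr i oC C0)) => //.
have oO : open O.
  rewrite openE => y [Cy Wy]; apply: filterI; first by move: oC; rewrite openE; exact.
  apply: (differentiable_continuous (dr y Cy)).
  by move: oW; rewrite openE; exact.
exists O; split => //.
have O0 y : O y -> y != 0 by move=> [/C0].
have sr : esmooth O (F \o @retr R n).
  apply: (esmooth_comp oO _ _ sF); first by move=> y [].
  by move=> i; exact: esmooth_retr.
apply: (esmooth_eq oO _ sr) => y; rewrite inE => -[Cy Wy] /=.
by rewrite hF//; exact: Cb.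
Qed.

End ball_cone.

Theorem theorem1p1 (R : realType) (n : nat) (rho : R)
    (rho_gt0 : 0 < rho) (rho_ltpi : rho < pi)
    (q : 'rV[R]_n.+1) (hq : sphere q)
    (h : 'rV[R]_n.+1 -> R) (hharm : harmonic_on (geodesic_ball q rho) h)
    (k : nat) (p : 'rV[R]_n.+1) (hp : geodesic_ball q rho p) :
  0 <= iter k (@laplace_beltrami R n) (fun x => `|h x| ^+ 2) p.
Proof.
have [sh lh] := hharm; have [sp _] := hp.
have coneE := ball_cone_sphere hq rho_gt0 rho_ltpi.
have oC := @open_ball_cone R n q rho.
have scaleC := @ball_cone_scale R n q rho.
have C0 := @ball_cone_neq0 R n q rho.
apply: (harmonic_sos_iter oC scaleC C0 _ _ _ sp); last exact/coneE.
apply: (harmonic_sos_sqr oC scaleC C0).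
  exact: (esmooth_retr_ball hq rho_gt0 rho_ltpi sh).
by move=> x Cx sx; apply: lh; exact/coneE.
Qed.
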